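(* Let $\{R_m(x,t)\}_{m\ge0}$ be the rational functions defined by $R_0=1$, $R_1=1-x$, and \[ R_m(x,t)=\Big(1-x-\frac{x^2}{1-x}(t-1)\Big)R_{m-1}(x,t)-x^2R_{m-2}(x,t)\quad(m\ge2). \] Write $a=1-x-\frac{x^2}{1-x}(t-1)$. Then for $m\ge1$, \[ F_m^{\mathrm{plt}}(x,t)=\frac{R_m(x,t)}{R_{m+1}(x,t)}=\cfrac{1}{a-\cfrac{x^2}{a-\cfrac{x^2}{\ddots\,a-\cfrac{x^2}{1-x}}}}, \] a continued fraction in which $a$ appears $m$ times (i.e. with $m+1$ fraction bars), and \[ F^{\mathrm{plt}}(x,t)=\cfrac{1}{a-\cfrac{x^2}{a-\cfrac{x^2}{a-\cdots}}}=\frac{1-2x-x^2(t-2)-\sqrt{1-4x-2x^2(t-2)+4x^3t+x^4t(t-4)}}{2(x^2-x^3)}. \]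
   Context: A Motzkin path of length $n$ is a sequence of $n$ steps $U$ ($+1$), $F$ ($0$), $D$ ($-1$) starting and ending at height $0$ and never going below $0$; it has height bounded by $m$ if all heights are at most $m$. A plateau is an occurrence of a consecutive subword $UF^kD$ for some $k\ge0$; $\mathrm{plt}(\mu)$ is the number of plateaus of $\mu$. With $\mathcal{M}_n^m$ the Motzkin paths of length $n$ with height bounded by $m$ and $\mathcal{M}_n$ all Motzkin paths of length $n$, $F_m^{\mathrm{plt}}(x,t)=\sum_n\sum_{\mu\in\mathcal{M}_n^m}t^{\mathrm{plt}(\mu)}x^n$ and $F^{\mathrm{plt}}(x,t)=\sum_n\sum_{\mu\in\mathcal{M}_n}t^{\mathrm{plt}(\mu)}x^n$. An infinite continued fraction denotes the formal power series limit of its finite truncations. *)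

(* Defs.v *)
From HB Require Import structures.
From mathcomp Require Import all_boot all_order all_algebra.
From mathcomp Require Import boolp.

Set Implicit Arguments.
Unset Strict Implicit.
Unset Printing Implicit Defensive.
Import Order.TTheory GRing.Theory Num.Theory.

Local Open Scope ring_scope.

(* Formal power series in one variable over R; [f n] is the coefficient of the
   n-th power of the variable, the product is the Cauchy product. *)
Record fps (R : Type) := Fps { fps_coef :> nat -> R }.

Lemma fpsP (R : Type) (f g : fps R) : (forall n, f n = g n) <-> f = g.
Proof.
split=> [|-> //]; case: f g => [f] [g] /= fg; congr Fps; exact/funext.
Qed.

HB.instance Definition _ (R : Type) := gen_eqMixin (fps R).
HB.instance Definition _ (R : Type) := gen_choiceMixin (fps R).

Section FpsZmodule.
Variable R : zmodType.
Implicit Types f g h : fps R.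

Definition fps_zero : fps R := Fps (fun=> 0).
Definition fps_opp f : fps R := Fps (fun n => - f n).
Definition fps_add f g : fps R := Fps (fun n => f n + g n).

Fact fps_addA : associative fps_add.
Proof. by move=> f g h; apply/fpsP => n /=; rewrite addrA. Qed.
Fact fps_addC : commutative fps_add.
Proof. by move=> f g; apply/fpsP => n /=; rewrite addrC. Qed.
Fact fps_add0 : left_id fps_zero fps_add.
Proof. by move=> f; apply/fpsP => n /=; rewrite add0r. Qed.
Fact fps_addN : left_inverse fps_zero fps_opp fps_add.
Proof. by move=> f; apply/fpsP => n /=; rewrite addNr. Qed.

HB.instance Definition _ :=
  GRing.isZmodule.Build (fps R) fps_addA fps_addC fps_add0 fps_addN.

Lemma fps0E n : (0 : fps R) n = 0. Proof. by []. Qed.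
Lemma fpsDE f g n : (f + g) n = f n + g n. Proof. by []. Qed.
Lemma fpsNE f n : (- f) n = - f n. Proof. by []. Qed.
Lemma fpsBE f g n : (f - g) n = f n - g n. Proof. by []. Qed.
End FpsZmodule.

Section FpsRing.
Variable R : comNzRingType.
Implicit Types f g h : fps R.

Definition fps_one : fps R := Fps (fun n => (n == 0%N)%:R).
Definition fps_mul f g : fps R :=
  Fps (fun n => \sum_(i < n.+1) f i * g (n - i)%N).

Lemma fps_mul_rev f g n : fps_mul f g n = \sum_(i < n.+1) f (n - i)%N * g i.
Proof.
rewrite /= (reindex_inj rev_ord_inj) /=.
by apply: eq_bigr => j _; rewrite (sub_ordK j).
Qed.

Fact fps_mulC : commutative fps_mul.
Proof.
move=> f g; apply/fpsP => n; rewrite fps_mul_rev.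
by apply: eq_bigr => j _; rewrite mulrC.
Qed.

Fact fps_mulA : associative fps_mul.
Proof.
move=> p q r; apply/fpsP => i; rewrite [RHS]fps_mul_rev.
pose coef3 j k := p j * (q (i - j - k)%N * r k).
transitivity (\sum_(j < i.+1) \sum_(k < i.+1 | (k <= i - j)%N) coef3 j k).
  apply: eq_bigr => j _; rewrite fps_mul_rev big_distrr /=.
  by rewrite (big_ord_narrow_leq (leq_subr _ _)).
rewrite (exchange_big_dep predT) //=; apply: eq_bigr => k _.
transitivity (\sum_(j < i.+1 | (j <= i - k)%N) coef3 j k).
  apply: eq_bigl => j; rewrite -ltnS -(ltnS j) -!subSn ?leq_ord //.
  by rewrite -subn_gt0 -(subn_gt0 j) -!subnDA addnC.
rewrite (big_ord_narrow_leq (leq_subr _ _)) big_distrl /=.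
by apply: eq_bigr => j _; rewrite /coef3 -!subnDA addnC mulrA.
Qed.

Fact fps_mul1 : left_id fps_one fps_mul.
Proof.
move=> f; apply/fpsP => n /=; rewrite big_ord_recl subn0 mul1r big1 ?addr0 //.
by move=> i _; rewrite mul0r.
Qed.

Fact fps_mulDl : left_distributive fps_mul (@fps_add R).
Proof.
move=> f g h; apply/fpsP => n /=; rewrite -big_split /=.
by apply: eq_bigr => i _; rewrite mulrDl.
Qed.

Fact fps_one_neq0 : fps_one != 0.
Proof.
apply/eqP => /(congr1 (fun f : fps R => f 0%N)) /eqP /=.
by rewrite oner_eq0.
Qed.

HB.instance Definition _ := GRing.Zmodule_isComNzRing.Build (fps R)
  fps_mulA fps_mulC fps_mul1 fps_mulDl fps_one_neq0.

Lemma fps1E n : (1 : fps R) n = (n == 0%N)%:R. Proof. by []. Qed.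
Lemma fpsME f g n : (f * g) n = \sum_(i < n.+1) f i * g (n - i)%N.
Proof. by []. Qed.

Definition fps_of_poly (p : {poly R}) : fps R := Fps (fun n => p`_n).

Fact fps_of_poly_is_zmod_morphism : zmod_morphism fps_of_poly.
Proof. by move=> p q; apply/fpsP => n /=; rewrite coefB. Qed.
HB.instance Definition _ := GRing.isZmodMorphism.Build {poly R} (fps R)
  fps_of_poly fps_of_poly_is_zmod_morphism.

Fact fps_of_poly_is_monoid_morphism : monoid_morphism fps_of_poly.
Proof.
by split=> [|p q]; apply/fpsP => n /=; rewrite ?coef1 // coefM.
Qed.
HB.instance Definition _ := GRing.isMonoidMorphism.Build {poly R} (fps R)
  fps_of_poly fps_of_poly_is_monoid_morphism.

Lemma fps_of_poly_inj : injective fps_of_poly.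
Proof. by move=> p q /fpsP pq; apply/polyP. Qed.

(* Convergence of a sequence of series for the adic topology: every coefficient
   is eventually constant, equal to that of the limit. *)
Definition fps_cvg (s : nat -> fps R) (f : fps R) : Prop :=
  forall n, exists N, forall k, (N <= k)%N -> s k n = f n.

Lemma fps_cvg_unique s f g : fps_cvg s f -> fps_cvg s g -> f = g.
Proof.
move=> sf sg; apply/fpsP => n; have [N fN] := sf n; have [M gM] := sg n.
by rewrite -(fN (maxn N M)) ?leq_maxl // gM ?leq_maxr.
Qed.

(* The series whose n-th coefficient is [c n [:: f 0; ...; f n.-1]]. *)
Fixpoint fps_rec_seq (c : nat -> seq R -> R) (n : nat) : seq R :=
  if n is n'.+1 then
    let s := fps_rec_seq c n' in rcons s (c n' s)
  else [::].
Definition fps_rec (c : nat -> seq R -> R) : fps R :=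
  Fps (fun n => c n (fps_rec_seq c n)).

Lemma size_fps_rec_seq c n : size (fps_rec_seq c n) = n.
Proof. by elim: n => //= n IHn; rewrite size_rcons IHn. Qed.

Lemma nth_fps_rec_seq c n i : (i < n)%N -> (fps_rec_seq c n)`_i = fps_rec c i.
Proof.
elim: n => //= n IHn; rewrite ltnS leq_eqVlt nth_rcons size_fps_rec_seq.
by case: eqP => [-> _|_ /= lt_in]; rewrite ?ltnn // lt_in IHn.
Qed.
End FpsRing.

Section FpsUnitRing.
Variable R : comUnitRingType.
Implicit Types f g : fps R.

Definition fps_unit : {pred fps R} := fun f => f 0%N \is a GRing.unit.

Definition fps_inv_rec f (n : nat) (s : seq R) : R :=
  (f 0%N)^-1 * ((n == 0%N)%:R - \sum_(i < n) f (n - i)%N * s`_i).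

Definition fps_inv f : fps R :=
  if fps_unit f then fps_rec (fps_inv_rec f) else f.

Fact fps_mulVf : {in fps_unit, left_inverse 1 fps_inv *%R}.
Proof.
move=> f uf; have u0 : f 0%N \is a GRing.unit by [].
rewrite /fps_inv ifT; last exact: uf.
apply/fpsP => n; rewrite fpsME fps1E big_ord_recr /= subnn.
have -> : fps_inv_rec f n (fps_rec_seq (fps_inv_rec f) n) =
  (f 0%N)^-1 * ((n == 0%N)%:R
     - \sum_(i < n) f (n - i)%N * fps_rec (fps_inv_rec f) i).
  rewrite /fps_inv_rec; congr (_ * (_ - _)).
  by apply: eq_bigr => i _; rewrite nth_fps_rec_seq.
rewrite [_^-1 * _]mulrC mulrVK //.
under eq_bigr => i _ do rewrite [_ * f _]mulrC.
by rewrite addrC subrK.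
Qed.

Fact fps_unitPl f g : g * f = 1 -> fps_unit f.
Proof.
move/fpsP/(_ 0%N); rewrite fpsME big_ord1 /= => gf1.
by apply/unitrPr; exists (g 0%N); rewrite mulrC.
Qed.

Fact fps_inv_out : {in [predC fps_unit], fps_inv =1 id}.
Proof. by move=> f uf; rewrite /fps_inv ifN. Qed.

HB.instance Definition _ := GRing.ComNzRing_hasMulInverse.Build (fps R)
  fps_mulVf fps_unitPl fps_inv_out.

(* The square root with constant term 1 of a series with constant term 1, by
   solving [s * s = f] coefficientwise; 2 must be a unit of R. *)
Definition fps_sqrt_rec f (n : nat) (s : seq R) : R :=
  if n is n'.+1 then
    2%:R^-1 * (f n - \sum_(1 <= i < n) s`_i * s`_(n - i))
  else 1.

Definition fps_sqrt f : fps R := fps_rec (fps_sqrt_rec f).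

Lemma fps_sqrt0 f : fps_sqrt f 0%N = 1.
Proof. by []. Qed.

Lemma fps_sqr_sqrt f :
  (2%:R : R) \is a GRing.unit -> f 0%N = 1 -> fps_sqrt f ^+ 2 = f.
Proof.
move=> u2 f0; apply/fpsP => -[|n]; rewrite expr2 fpsME.
  by rewrite big_ord1 fps_sqrt0 mulr1 f0.
rewrite big_ord_recr big_ord_recl subn0 subnn fps_sqrt0 mul1r mulr1.
have -> : \sum_(i < n) fps_sqrt f (lift ord0 i) *
              fps_sqrt f (n.+1 - lift ord0 i)%N =
   \sum_(1 <= i < n.+1) fps_sqrt f i * fps_sqrt f (n.+1 - i)%N.
  by rewrite big_add1 big_mkord; apply: eq_bigr.
set S := \sum_(1 <= i < n.+1) _.
suff -> : fps_sqrt f n.+1 = 2%:R^-1 * (f n.+1 - S).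
  rewrite -[LHS]/(_ + _ + _) addrAC -mulr2n -[(_^-1 * _) *+ 2]mulr_natl.
  by rewrite mulrA divrr // mul1r subrK.
rewrite -[LHS]/(_ * (_ - \sum_(1 <= i < n.+1)
  (fps_rec_seq (fps_sqrt_rec f) n.+1)`_i *
  (fps_rec_seq (fps_sqrt_rec f) n.+1)`_(n.+1 - i))).
congr (_ * (_ - _)); apply: eq_big_nat => i /andP[i0 lt_i].
by rewrite !nth_fps_rec_seq // ltn_subrL i0.
Qed.
End FpsUnitRing.

Section FpsIdomain.
Variable R : idomainType.

Fact fps_mulf_eq0 : GRing.integral_domain_axiom (fps R).
Proof.
move=> f g fg0; apply/orP; case: eqP => [|f0]; [by left | right].
apply/eqP/fpsP; apply: contrapT => /existsNP[j0 gj0].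
have fex : exists i, f i != 0.
  apply: contrapT => fN; apply: f0; apply/fpsP => i.
  by apply/eqP; apply: contrapT => /negP fi; apply: fN; exists i.
have gex : exists j, g j != 0 by exists j0; apply/eqP.
case: (ex_minnP fex) => i fi mini; case: (ex_minnP gex) => j gj minj.
have lti k : (k < i)%N -> f k = 0.
  by move=> ki; apply: contraTeq ki => /mini; rewrite leqNgt.
have ltj k : (k < j)%N -> g k = 0.
  by move=> kj; apply: contraTeq kj => /minj; rewrite leqNgt.
have /fpsP/(_ (i + j)%N) := fg0; rewrite fpsME fps0E.
have ltij : (i < (i + j).+1)%N by rewrite ltnS leq_addr.
rewrite (bigD1 (Ordinal ltij)) //= addKn big1 ?addr0 => [/eqP|k ki].
  by rewrite mulf_eq0 (negbTE fi) (negbTE gj).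
have [ltk|gek] := ltnP k i; first by rewrite lti ?mul0r.
have lt_ik : (i < k)%N by rewrite ltn_neqAle gek andbT eq_sym.
by rewrite ltj ?mulr0 // ltn_subLR ?ltn_add2r // -ltnS.
Qed.

HB.instance Definition _ :=
  GRing.ComUnitRing_isIntegral.Build (fps R) fps_mulf_eq0.
End FpsIdomain.

Lemma fps_sqrt_unique (R : idomainType) (f s : fps R) :
  (2%:R : R) \is a GRing.unit -> f 0%N = 1 ->
  s ^+ 2 = f -> s 0%N = 1 -> s = fps_sqrt f.
Proof.
move=> u2 f0 sf s0; have /eqP := fps_sqr_sqrt u2 f0.
rewrite -sf eqf_sqr => /orP[/eqP -> //|/eqP /fpsP /(_ 0%N)].
rewrite fps_sqrt0 fpsNE s0 => /eqP; rewrite -subr_eq0 opprK => /eqP two0.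
by move: u2; rewrite -[2%:R]/(1 + 1) two0 unitr0.
Qed.

Notation "x %:F" := (FracField.tofrac x) : ring_scope.

Section Expansion.
Variable R : idomainType.
Implicit Types r s : {fraction {poly R}}.

(* The field embedding Frac(R[x]) -> Frac(R[[x]]); a series f is the expansion
   of the rational function r iff [fps_expand r = f%:F]. *)
Definition fps_expand r : {fraction fps R} :=
  (fps_of_poly \n_(repr r))%:F / (fps_of_poly \d_(repr r))%:F.

Let toF_neq0 (p : {poly R}) : p != 0 -> (fps_of_poly p)%:F != 0.
Proof.
by move=> p0; rewrite tofrac_eq0 -(rmorph0 (@fps_of_poly R)) (inj_eq (@fps_of_poly_inj R)).
Qed.

Let fracE r : r = (\n_(repr r))%:F / (\d_(repr r))%:F.
Proof.
have d0 : \d_(repr r) != 0 by exact: denom_ratioP.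
apply: (canRL (mulfK _)); first by rewrite tofrac_eq0.
rewrite -{1}[r]reprK; unlock FracField.tofrac; rewrite -[LHS]FracField.pi_mul.
apply/eqmodP => /=; rewrite FracField.equivfE /FracField.mulf.
by rewrite !numden_Ratio ?mulf_neq0 ?oner_neq0 // !mulr1 mulrC.
Qed.

Lemma fps_expand_div (p q : {poly R}) : q != 0 ->
  fps_expand (p%:F / q%:F) = (fps_of_poly p)%:F / (fps_of_poly q)%:F.
Proof.
move=> q0; set r := p%:F / q%:F; have := fracE r.
have d0 : \d_(repr r) != 0 by exact: denom_ratioP.
rewrite {1}/r => /eqP; rewrite eqr_div ?tofrac_eq0 // -!tofracM tofrac_eq.
move=> /eqP E; apply/eqP; rewrite eqr_div ?toF_neq0 //.
by rewrite -!rmorphM -E.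
Qed.

Lemma fps_expand_poly (p : {poly R}) : fps_expand p%:F = (fps_of_poly p)%:F.
Proof.
by rewrite -[p%:F]divr1 -tofrac1 fps_expand_div ?oner_neq0 // !rmorph1 divr1.
Qed.

Fact fps_expand_is_zmod_morphism : zmod_morphism fps_expand.
Proof.
move=> r s; rewrite {1}(fracE r) {1}(fracE s) /fps_expand.
set n1 := \n_(repr r); set d1 := \d_(repr r).
set n2 := \n_(repr s); set d2 := \d_(repr s).
have d10 : d1 != 0 by exact: denom_ratioP.
have d20 : d2 != 0 by exact: denom_ratioP.
rewrite -!mulNr !addf_div ?toF_neq0 ?tofrac_eq0 //.
by rewrite -!rmorphN -!rmorphM -!rmorphD -/(fps_expand _) fps_expand_div ?mulf_neq0.
Qed.
HB.instance Definition _ := GRing.isZmodMorphism.Build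
  {fraction {poly R}} {fraction fps R} fps_expand fps_expand_is_zmod_morphism.

Fact fps_expand_is_monoid_morphism : monoid_morphism fps_expand.
Proof.
split=> [|r s].
  by rewrite -[X in fps_expand X]tofrac1 fps_expand_poly !rmorph1.
rewrite {1}(fracE r) {1}(fracE s) mulf_div -!rmorphM fps_expand_div.
  by rewrite !rmorphM -mulf_div.
by rewrite mulf_neq0 //; exact: denom_ratioP.
Qed.
HB.instance Definition _ := GRing.isMonoidMorphism.Build
  {fraction {poly R}} {fraction fps R} fps_expand fps_expand_is_monoid_morphism.
End Expansion.

Inductive step := U | F | D.

Definition step_to_opt (s : step) : option bool :=
  match s with U => Some true | F => None | D => Some false end.
Definition opt_to_step (o : option bool) : step :=
  match o with Some true => U | None => F | Some false => D end.
Fact step_to_optK : cancel step_to_opt opt_to_step. Proof. by case. Qed.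
HB.instance Definition _ := Finite.copy step (can_type step_to_optK).

Definition step_val (s : step) : int :=
  match s with U => 1 | F => 0 | D => -1 end.

Definition height_after (w : seq step) (k : nat) : int :=
  \sum_(s <- take k w) step_val s.

Definition motzkin (w : seq step) : bool :=
  (height_after w (size w) == 0) &&
  [forall k : 'I_(size w).+1, 0 <= height_after w k].

Definition height_bounded (m : nat) (w : seq step) : bool :=
  [forall k : 'I_(size w).+1, height_after w k <= m%:Z].

(* An occurrence of a plateau is a pair (i, k) such that the factor of w
   starting at position i is U F^k D. *)
Definition plt (w : seq step) : nat :=
  #|[set ik : 'I_(size w) * 'I_(size w)
      | prefix (U :: rcons (nseq ik.2 F) D) (drop ik.1 w)]|.

(* Series in x over Q[t]: the variable of the coefficient ring is t. *)
Definition Fplt_bounded (m : nat) : fps {poly rat} :=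
  Fps (fun n => \sum_(mu : n.-tuple step | motzkin mu && height_bounded m mu)
                  'X ^+ plt mu).

Definition Fplt : fps {poly rat} :=
  Fps (fun n => \sum_(mu : n.-tuple step | motzkin mu) 'X ^+ plt mu).

(* Q(x,t), as the fraction field of Q[t][x]. *)
Notation ratfun := {fraction {poly {poly rat}}}.

Definition x_rat : ratfun := 'X%:F.
Definition t_rat : ratfun := ('X%:P)%:F.

Definition a_plt : ratfun := 1 - x_rat - x_rat ^+ 2 / (1 - x_rat) * (t_rat - 1).

Fixpoint R_plt (m : nat) : ratfun :=
  match m with
  | 0 => 1
  | 1 => 1 - x_rat
  | (m''.+1 as m').+1 => a_plt * R_plt m' - x_rat ^+ 2 * R_plt m''
  end.

(* 1 / (a - x^2 / (a - ... x^2 / (a - x^2 / z))) with m occurrences of a. *)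
Definition cfrac_plt (m : nat) (z : ratfun) : ratfun :=
  1 / iter m (fun d => a_plt - x_rat ^+ 2 / d) z.

(* The series f is the formal power series limit of the expansions of the
   rational functions c k. *)
Definition ratfun_cvg (c : nat -> ratfun) (f : fps {poly rat}) : Prop :=
  exists s : nat -> fps {poly rat},
    (forall k, fps_expand (c k) = (s k)%:F) /\ fps_cvg s f.

Definition x_ser : fps {poly rat} := fps_of_poly 'X.
Definition t_ser : fps {poly rat} := fps_of_poly 'X%:P.

Lemma two_unit_polyQ : (2%:R : {poly rat}) \is a GRing.unit.
Proof.
rewrite -[2%:R](rmorph_nat (@polyC rat)); apply: (rmorph_unit (@polyC rat)).
by rewrite unitfE pnatr_eq0.
Qed.

(* Main.v *)
Require Import Defs.
From HB Require Import structures.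
From mathcomp Require Import all_boot all_order all_algebra.
From mathcomp Require Import ring zify.

Set Implicit Arguments.
Unset Strict Implicit.
Unset Printing Implicit Defensive.
Import Order.TTheory GRing.Theory Num.Theory.

Local Open Scope ring_scope.

(** Read a path as the run of an automaton whose state is the current height [h]
    and a flag telling whether the last non-flat step was [U]; a plateau is then
    a [D] step read with the flag raised.  Let [A_h] and [B_h] be the series of
    the paths from height [h] to height [0] inside the strip [0..m] with the flag
    lowered, resp. raised.  The first step gives linear equations for them, and
    [(1 - x) (B_h - A_h) = x (t - 1) A_(h-1)] eliminates the [B_h], leaving the
    tridiagonal system [a A_h = [h = 0] + x A_(h+1) + x A_(h-1)] for [h < m], with
    [(1 - x) A_m = x A_(m-1)].  Solving from the top height downwards produces the
    continued fraction for [A_0].  Since paths of length [n] never exceed height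
    [n], the unbounded series [F] satisfies [F (a - x^2 F) = 1], whence the limit
    and the quadratic formula. *)

(** * Power series *)

Lemma fps_coef0M (R : comNzRingType) (f g : fps R) :
  (f * g) 0%N = f 0%N * g 0%N.
Proof. by rewrite fpsME big_ord1. Qed.

Lemma fps_unitE (R : comUnitRingType) (f : fps R) :
  (f \is a GRing.unit) = (f 0%N \is a GRing.unit).
Proof. by []. Qed.

Lemma fps_unit_coef0_1 (R : comUnitRingType) (f : fps R) :
  f 0%N = 1 -> f \is a GRing.unit.
Proof. by move=> f0; rewrite fps_unitE f0 unitr1. Qed.

Lemma fps_coefXM (R : comNzRingType) (f : fps R) n :
  (fps_of_poly 'X * f) n = if n is n'.+1 then f n' else 0.
Proof.
case: n => [|n]; first by rewrite fps_coef0M /= coefX mul0r.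
rewrite fpsME big_ord_recl /= coefX mul0r add0r big_ord_recl /= coefX mul1r.
rewrite big1 ?addr0 => [|i _]; last by rewrite /= coefX mul0r.
by rewrite subn1.
Qed.

Lemma fps_coefXnM_lt (R : comNzRingType) (f : fps R) k n :
  (n < k)%N -> (fps_of_poly 'X ^+ k * f) n = 0.
Proof.
elim: k n => // k IHk n; rewrite exprS -mulrA fps_coefXM.
by case: n => // n; rewrite ltnS => /IHk.
Qed.

Lemma eq_coef_fpsM (R : comNzRingType) (f f' g g' : fps R) n :
  (forall i, (i <= n)%N -> f i = f' i) ->
  (forall i, (i <= n)%N -> g i = g' i) ->
  forall i, (i <= n)%N -> (f * g) i = (f' * g') i.
Proof.
move=> ff' gg' i le_in; rewrite !fpsME; apply: eq_bigr => j _.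
rewrite ff' ?gg' //; first exact: leq_trans (leq_subr _ _) le_in.
by apply: leq_trans le_in; rewrite -ltnS.
Qed.

(** * Plateaus and heights read from left to right *)

Fixpoint plt_run (b : bool) (w : seq step) : nat :=
  match w with
  | [::] => 0
  | U :: w' => plt_run true w'
  | F :: w' => plt_run b w'
  | D :: w' => b + plt_run false w'
  end.

Fixpoint starts_FsD (w : seq step) : bool :=
  match w with
  | D :: _ => true
  | F :: w' => starts_FsD w'
  | _ => false
  end.

(** The automaton counts a plateau at its closing [D], while [plt] locates it at its opening [U].
    This passes from one to the other: a raised flag matters only until the next non-flat step. *)
Lemma plt_run_true w : plt_run true w = (starts_FsD w + plt_run false w)%N.
Proof. by elim: w => [|[] w IHw]. Qed.

(** At most one [k] can match, the number of leading flat steps of [w]; [N] only has to be large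
    enough not to miss it. *)
Lemma starts_FsD_sum w N : (size w <= N)%N ->
  (\sum_(k < N) prefix (rcons (nseq k F) D) w)%N = starts_FsD w.
Proof.
elim: w N => [|s w IHw] [|N] //=.
- by rewrite big_ord0.
- by move=> _; rewrite big1 // => -[[|k] ? /=] _.
rewrite ltnS => le_wN; rewrite big_ord_recl /=.
case: s => /=.
- by rewrite big1.
- by rewrite -(IHw N).
- by rewrite prefix0s big1.
Qed.

(** Decoupling [N] from [size w] keeps the range of [k] fixed while the induction shortens the
    word. *)
Lemma plt_run_sum w N : (size w <= N)%N ->
  (\sum_(i < size w) \sum_(k < N)
     prefix (U :: rcons (nseq k F) D) (drop i w))%N = plt_run false w.
Proof.
elim: w => [|s w IHw] /= le_wN; first by rewrite big_ord0.
rewrite big_ord_recl /= IHw; last exact: ltnW.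
case: s => /=; [|by rewrite big1 | by rewrite big1].
by rewrite starts_FsD_sum ?plt_run_true // ltnW.
Qed.

Lemma plt_plt_run w : plt w = plt_run false w.
Proof.
rewrite -(plt_run_sum (leqnn _)) /plt -sum1_card big_mkcond pair_bigA /=.
by apply: eq_bigr => -[i k] _ /=; rewrite inE; case: ifP.
Qed.

Fixpoint in_strip (m h : nat) (w : seq step) : bool :=
  match w with
  | [::] => h == 0
  | U :: w' => (h < m) && in_strip m h.+1 w'
  | F :: w' => in_strip m h w'
  | D :: w' => (0 < h) && in_strip m h.-1 w'
  end%N.

Lemma forall_ordS n (P : pred nat) :
  [forall k : 'I_n.+1, P k] = P 0%N && [forall k : 'I_n, P k.+1].
Proof.
apply/forallP/andP => [Pn|[P0 /forallP Pn] [[|k] /= lt_k]] //.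
  by split; [exact: (Pn ord0) | apply/forallP => k; exact: (Pn (lift ord0 k))].
exact: (Pn (Ordinal (lt_k : (k < n)%N))).
Qed.

Lemma height_after0 w : height_after w 0 = 0.
Proof. by rewrite /height_after take0 big_nil. Qed.

Lemma height_after_cons s w k :
  height_after (s :: w) k.+1 = step_val s + height_after w k.
Proof. by rewrite /height_after /= big_cons. Qed.

Lemma in_stripE m h w : (h <= m)%N ->
  in_strip m h w =
  (h%:Z + height_after w (size w) == 0) &&
  [forall k : 'I_(size w).+1, 0 <= h%:Z + height_after w k <= m%:Z].
Proof.
elim: w h => [|s w IHw] h le_hm; have h_in : 0 <= h%:Z <= m%:Z by lia.
  rewrite (forall_ordS _ (fun k => 0 <= h%:Z + height_after [::] k <= m%:Z)).
  rewrite height_after0 addr0 h_in /=.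
  by case: forallP => [_|[]]; [rewrite andbT | case].
rewrite (forall_ordS _ (fun k => 0 <= h%:Z + height_after (s :: w) k <= m%:Z)).
rewrite height_after0 addr0 h_in /=.
rewrite height_after_cons addrA.
under eq_forallb => k do rewrite height_after_cons addrA.
(* A first step that leaves the strip already breaks the bounds at the empty prefix of the remaining
   word. *)
have out (c : int) : ~~ (0 <= c <= m%:Z) ->
    [forall k : 'I_(size w).+1, 0 <= c + height_after w k <= m%:Z] = false.
  move=> Nc; apply: contraNF Nc => /forallP/(_ ord0).
  by rewrite height_after0 addr0.
case: s => /=.
- case: ltnP => [lt_hm|le_mh] /=.
    by rewrite IHw //; have -> : h%:Z + 1 = h.+1%:Z by lia.
  by rewrite out ?andbF //; lia.
- by rewrite IHw // addr0.
- case: h le_hm {h_in} => [|h] le_hm /=; first by rewrite out ?andbF.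
  rewrite IHw ?(ltnW le_hm) //.
  by have -> : h.+1%:Z + -1 = h%:Z by lia.
Qed.

Lemma in_strip0E m w : in_strip m 0 w = motzkin w && height_bounded m w.
Proof.
rewrite in_stripE // /motzkin /height_bounded add0r -andbA; congr (_ && _).
under eq_forallb => k do rewrite add0r.
apply/forallP/andP => [H|[/forallP H1 /forallP H2] k]; last by rewrite H1 H2.
by split; apply/forallP => k; have /andP[] := H k.
Qed.

Lemma height_after_le_size w k : height_after w k <= (size w)%:Z.
Proof.
elim: w k => [|s w IHw] [|k]; rewrite ?height_after0 //.
  by rewrite /height_after big_nil.
rewrite height_after_cons /=; have := IHw k.
by case: s => /=; lia.
Qed.

Lemma height_bounded_size m w : (size w <= m)%N -> height_bounded m w.
Proof.
move=> le_wm; apply/forallP => k.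
by apply: le_trans (height_after_le_size _ _) _; rewrite lez_nat.
Qed.

(** * The series of the automaton *)

Definition strip_ser (m h : nat) (b : bool) : fps {poly rat} :=
  Fps (fun n => \sum_(w : n.-tuple step | in_strip m h w) 'X ^+ plt_run b w).

Lemma Fplt_bounded_strip_ser m : Fplt_bounded m = strip_ser m 0 false.
Proof.
apply/fpsP => n /=; apply: eq_big => [w|w _]; first by rewrite in_strip0E.
by rewrite plt_plt_run.
Qed.

(** Each step climbs by at most one, so the bound [m] excludes no path of length [n]. *)
Lemma Fplt_coef_bounded m n : (n <= m)%N -> Fplt n = Fplt_bounded m n.
Proof.
move=> le_nm; apply: eq_bigl => w.
by rewrite height_bounded_size ?andbT // size_tuple.
Qed.

Lemma sum_step (V : nmodType) (f : step -> V) : \sum_s f s = f U + f F + f D.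
Proof.
rewrite (bigD1 U) // (bigD1 F) // (bigD1 D) //= big1 ?addr0 ?addrA //.
by case.
Qed.

Lemma sum_tupleS (T : finType) (V : nmodType) n (P : pred (seq T))
    (f : seq T -> V) :
  \sum_(w : n.+1.-tuple T | P w) f w =
  \sum_(s : T) \sum_(w : n.-tuple T | P (s :: w)) f (s :: w).
Proof.
rewrite pair_big_dep /=.
rewrite (reindex (fun p : T * n.-tuple T => [tuple of p.1 :: p.2])) //=.
exists (fun w : n.+1.-tuple T => (thead w, [tuple of behead w])).
  by case=> s w _; congr pair; apply: val_inj.
by move=> w _; rewrite /= -tuple_eta.
Qed.

Local Notation A m h := (strip_ser m h false).
Local Notation B m h := (strip_ser m h true).

(** The summands are the empty path and the paths starting with [U], [F], [D]. [U] raises the flag,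
    [F] keeps it, and [D] lowers it, paying [t] if it was raised; a step leaving the strip
    contributes 0. *)
Lemma strip_ser_first_step m h b :
  strip_ser m h b =
  (h == 0%N)%:R + x_ser * (if (h < m)%N then B m h.+1 else 0)
  + x_ser * strip_ser m h b
  + x_ser * (if (0 < h)%N then (if b then t_ser else 1) * A m h.-1 else 0).
Proof.
have coef_t (f : fps {poly rat}) n : (t_ser * f) n = 'X * f n.
  rewrite fpsME big_ord_recl /= coefC subn0 big1 ?addr0 // => i _.
  by rewrite coefC mul0r.
apply/fpsP => -[|n]; rewrite !fpsDE !fps_coefXM.
  rewrite !addr0 /= big_mkcond (big_pred1 [tuple]) /= => [|w]; last first.
    by rewrite [w]tuple0; apply/esym/eqP/val_inj.
  by case: eqP.
have -> : ((h == 0%N)%:R : fps {poly rat}) n.+1 = 0 by case: eqP.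
rewrite add0r /= (sum_tupleS n (in_strip m h) (fun w => 'X ^+ plt_run b w)).
rewrite sum_step /=; congr (_ + _ + _).
- by case: ifP => _ //; rewrite big_pred0.
- case: ifP => _; last by rewrite big_pred0.
  case: b; rewrite ?mul1r ?coef_t //= big_distrr /=.
  by apply: eq_bigr => w _; rewrite exprS.
Qed.

Definition a_ser : fps {poly rat} :=
  1 - x_ser - x_ser ^+ 2 / (1 - x_ser) * (t_ser - 1).

Lemma coef0_x_ser : x_ser 0%N = 0.
Proof. by rewrite /= coefX. Qed.

Lemma coef0_1Bx_ser : (1 - x_ser) 0%N = 1.
Proof. by rewrite fpsBE coef0_x_ser subr0. Qed.

Lemma unit_1Bx_ser : 1 - x_ser \is a GRing.unit.
Proof. exact: fps_unit_coef0_1 coef0_1Bx_ser. Qed.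

Lemma coef0_a_ser : a_ser 0%N = 1.
Proof.
rewrite /a_ser fpsBE coef0_1Bx_ser expr2 -!mulrA fps_coef0M coef0_x_ser.
by rewrite mul0r subr0.
Qed.

Lemma coef0_a_serB f : (a_ser - x_ser ^+ 2 * f) 0%N = 1.
Proof.
by rewrite fpsBE coef0_a_ser expr2 -mulrA fps_coef0M coef0_x_ser mul0r subr0.
Qed.

Lemma unit_a_serB f : a_ser - x_ser ^+ 2 * f \is a GRing.unit.
Proof. exact: fps_unit_coef0_1 (coef0_a_serB f). Qed.

Lemma mul_1Bx_a_ser :
  (1 - x_ser) * a_ser = (1 - x_ser) ^+ 2 - x_ser ^+ 2 * (t_ser - 1).
Proof.
rewrite /a_ser mulrBr -expr2; congr (_ - _).
by rewrite mulrA mulrCA divrr ?mulr1 // unit_1Bx_ser.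
Qed.

(** Subtract the two first-step equations: the [U] terms agree, as [U] raises the flag in either
    state, so only the [F] and [D] terms survive. *)
Lemma strip_ser_flag m h :
  (1 - x_ser) * (B m h.+1 - A m h.+1) = x_ser * (t_ser - 1) * A m h.
Proof.
have := strip_ser_first_step m h.+1 true.
have := strip_ser_first_step m h.+1 false.
rewrite /=; set c := (if _ then _ else _) => hA hB.
rewrite [LHS](_ : _ = B m h.+1 - x_ser * B m h.+1
  - (A m h.+1 - x_ser * A m h.+1)); last by ring.
(* Both equations are recursive, so each is unfolded at one occurrence only. *)
by rewrite {1}hB {1}hA; ring.
Qed.

Lemma strip_ser_top m : (1 - x_ser) * A m.+1 m.+1 = x_ser * A m.+1 m.
Proof.
rewrite mulrBl {1}strip_ser_first_step ltnn /=; ring.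
Qed.

Lemma strip_ser_inner m h : (h < m)%N ->
  a_ser * A m h = (h == 0%N)%:R + x_ser * A m h.+1
                  + x_ser * (if (0 < h)%N then A m h.-1 else 0).
Proof.
(* Multiplying by [1 - x] clears the denominator of [a], and [strip_ser_flag] then trades [B] at
   [h.+1] for [A]. *)
move=> lt_hm; apply: (mulrI unit_1Bx_ser).
have hB := strip_ser_flag m h.
have := strip_ser_first_step m h false; rewrite lt_hm mul1r.
set e := _%:R; set c := (if _ then _ else _); set A0 := A m h => hA.
rewrite mulrA mul_1Bx_a_ser.
have hA' : (1 - x_ser) * A0 = e + x_ser * B m h.+1 + x_ser * c.
  by rewrite mulrBl mul1r {1}hA; ring.
have -> : ((1 - x_ser) ^+ 2 - x_ser ^+ 2 * (t_ser - 1)) * A0 =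
    (1 - x_ser) * ((1 - x_ser) * A0) - x_ser * (x_ser * (t_ser - 1) * A0).
  by ring.
by rewrite hA' -hB; ring.
Qed.

(** * Continued fractions of series *)

(** Counterpart of [cfrac_plt] among series, where every denominator containing [a] has constant
    term 1 and is thus a unit. *)
Fixpoint cfrac_ser (z : fps {poly rat}) (m : nat) : fps {poly rat} :=
  if m is m'.+1 then (a_ser - x_ser ^+ 2 * cfrac_ser z m')^-1 else z^-1.

(** Induction on the distance [j] from height [h.+1] to the top: substituting the ratio one level up
    into the tridiagonal equation gives [(a - x^2 C_j) A_(h+1) = x A_h], with [C_j] the fraction of
    depth [j]. *)
Lemma strip_ser_ratio m h j : (h + j)%N = m ->
  A m.+1 h.+1 = x_ser * cfrac_ser (1 - x_ser) j * A m.+1 h.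
Proof.
elim: j h => [|j IHj] h.
  rewrite addn0 => <- /=; apply: (mulrI unit_1Bx_ser); rewrite strip_ser_top.
  by rewrite mulrA mulrCA divrr ?mulr1 // unit_1Bx_ser.
move=> def_m; apply: (mulrI (unit_a_serB (cfrac_ser (1 - x_ser) j))).
have lt_hm : (h.+1 < m.+1)%N by lia.
rewrite mulrBl strip_ser_inner // (IHj h.+1) -?def_m ?addSnnS //= add0r.
rewrite [RHS]mulrA [_ * (x_ser * _)]mulrCA divrr ?unit_a_serB //; ring.
Qed.

Lemma Fplt_bounded_cfrac m : Fplt_bounded m = cfrac_ser (1 - x_ser) m.
Proof.
rewrite Fplt_bounded_strip_ser; case: m => [|m] /=.
  apply: (mulrI unit_1Bx_ser); rewrite divrr ?unit_1Bx_ser //.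
  by rewrite mulrBl {1}strip_ser_first_step /=; ring.
apply: (mulrI (unit_a_serB (cfrac_ser (1 - x_ser) m))).
rewrite divrr ?unit_a_serB // mulrBl strip_ser_inner //=.
by rewrite (@strip_ser_ratio m 0 m) //; ring.
Qed.

(** The bounded series satisfy [F_(n+1) (a - x^2 F_n) = 1], and up to degree [n] both agree with
    [Fplt]. *)
Lemma Fplt_quadratic : Fplt * (a_ser - x_ser ^+ 2 * Fplt) = 1.
Proof.
apply/fpsP => n; transitivity
    ((Fplt_bounded n.+1 * (a_ser - x_ser ^+ 2 * Fplt_bounded n)) n).
  apply: (@eq_coef_fpsM _ _ _ _ _ n) => // i le_in.
    by apply: Fplt_coef_bounded; exact: leqW.
  rewrite !fpsBE; congr (_ - _); apply: (@eq_coef_fpsM _ _ _ _ _ n) => // j.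
  exact: Fplt_coef_bounded.
by rewrite !Fplt_bounded_cfrac [cfrac_ser _ n.+1]/= mulVr // unit_a_serB.
Qed.

(** [Fplt] is a fixed point of the contraction sending [f] to [1 / (a - x^2 f)], so the tail [z] is
    irrelevant in the limit. *)
Lemma cfrac_ser_cvg z : fps_cvg (cfrac_ser z) Fplt.
Proof.
have diffE k : exists g, cfrac_ser z k - Fplt = x_ser ^+ k * g.
  elim: k => [|k [g IHk]].
    by exists (cfrac_ser z 0 - Fplt); rewrite expr0 mul1r.
  (* Each level gains [x^2], from [c_(k+1) - F = x^2 c_(k+1) F (c_k - F)]; one factor [x] goes to
     the power and the other into the witness. *)
  pose c := cfrac_ser z k.+1; exists (x_ser * c * Fplt * g).
  have cE : c * (a_ser - x_ser ^+ 2 * cfrac_ser z k) = 1.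
    by rewrite mulVr ?unit_a_serB.
  rewrite [RHS](_ : _ = x_ser ^+ 2 * c * Fplt * (x_ser ^+ k * g)); last first.
    by rewrite exprS; ring.
  transitivity (c * (Fplt * (a_ser - x_ser ^+ 2 * Fplt))
                - Fplt * (c * (a_ser - x_ser ^+ 2 * cfrac_ser z k))).
    by rewrite Fplt_quadratic cE !mulr1.
  by rewrite -IHk; ring.
move=> n; exists n.+1 => k lt_nk; have [g gE] := diffE k.
by apply/eqP; rewrite -subr_eq0 -fpsBE gE fps_coefXnM_lt.
Qed.

Lemma Fplt_sqrt :
  1 - 2%:R * x_ser - x_ser ^+ 2 * (t_ser - 2%:R)
      - fps_sqrt (1 - 4%:R * x_ser - 2%:R * x_ser ^+ 2 * (t_ser - 2%:R)
                    + 4%:R * x_ser ^+ 3 * t_ser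
                    + x_ser ^+ 4 * t_ser * (t_ser - 4%:R))
  = 2%:R * (x_ser ^+ 2 - x_ser ^+ 3) * Fplt.
Proof.
set disc := (X in fps_sqrt X).
(* Completing the square: [s] is [(1 - x) (a - 2 x^2 F)], and the quadratic equation removes [F]
   from its square. *)
pose s := (1 - x_ser) * a_ser - 2%:R * (x_ser ^+ 2 - x_ser ^+ 3) * Fplt.
(* This form shows the constant term 1, which selects the sign of the root. *)
have sE : s = 1 + x_ser * (- 2%:R + x_ser * (2%:R - t_ser)
                           - 2%:R * (x_ser - x_ser ^+ 2) * Fplt).
  by rewrite /s mul_1Bx_a_ser; ring.
have coef0_1Dx f : (1 + x_ser * f) 0%N = 1.
  by rewrite fpsDE fps_coefXM addr0.
have <- : s = fps_sqrt disc.
  apply: fps_sqrt_unique; rewrite ?two_unit_polyQ ?sE ?coef0_1Dx //.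
    rewrite [disc](_ : _ = 1 + x_ser * (- 4%:R - 2%:R * x_ser * (t_ser - 2%:R)
      + 4%:R * x_ser ^+ 2 * t_ser + x_ser ^+ 3 * t_ser * (t_ser - 4%:R))).
      exact: coef0_1Dx.
    by rewrite /disc; ring.
  rewrite -sE.
  transitivity (((1 - x_ser) * a_ser) ^+ 2 - 4%:R * x_ser ^+ 2
     * (1 - x_ser) ^+ 2 * (Fplt * (a_ser - x_ser ^+ 2 * Fplt))).
    by rewrite /s; ring.
  by rewrite Fplt_quadratic mul_1Bx_a_ser /disc; ring.
by rewrite /s mul_1Bx_a_ser; ring.
Qed.

(** * Expansions of rational functions *)

Lemma tofracV (R : idomainType) (f : R) :
  f \is a GRing.unit -> (f^-1)%:F = (f%:F)^-1.
Proof. exact: rmorphV. Qed.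

Lemma fps_expand_eq0 (R : idomainType) (r : {fraction {poly R}}) :
  (fps_expand r == 0) = (r == 0).
Proof. exact: fmorph_eq0. Qed.

Lemma fps_expand_x : fps_expand x_rat = x_ser%:F.
Proof. exact: fps_expand_poly. Qed.

Lemma fps_expand_1Bx : fps_expand (1 - x_rat) = (1 - x_ser)%:F.
Proof. by rewrite !rmorphB !rmorph1 /= fps_expand_x. Qed.

Lemma fps_expand_a : fps_expand a_plt = a_ser%:F.
Proof.
rewrite /a_plt /a_ser [LHS]rmorphB [RHS]rmorphB /= fps_expand_1Bx.
congr (_ - _); rewrite !expr2 !rmorphM /= fmorphV /= fps_expand_1Bx.
by rewrite tofracV ?unit_1Bx_ser // !rmorphB !rmorph1 /= !fps_expand_poly.
Qed.

Lemma fps_expand_cfrac z (z' : fps {poly rat}) m :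
  z' \is a GRing.unit -> fps_expand z = z'%:F ->
  fps_expand (cfrac_plt m z) = (cfrac_ser z' m)%:F.
Proof.
rewrite /cfrac_plt div1r fmorphV /= => uz' zE; elim: m => [|m IHm] /=.
  by rewrite zE tofracV.
rewrite tofracV ?unit_a_serB //; congr _^-1; move: (iter m _ z) IHm => d IHm.
rewrite [LHS]rmorphB [RHS]rmorphB /= fps_expand_a !expr2 !rmorphM fmorphV /=.
by rewrite IHm fps_expand_x.
Qed.

Lemma R_pltSS m :
  R_plt m.+2 = a_plt * R_plt m.+1 - x_rat ^+ 2 * R_plt m.
Proof. by []. Qed.

Lemma R_plt_neq0 m : R_plt m != 0.
Proof.
(* Constant term 1 of the expansion survives the recurrence, whereas nonvanishing alone would
   not. *)
suff [r r0 rE] : exists2 r : fps {poly rat},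
    r 0%N = 1 & fps_expand (R_plt m) = r%:F.
  rewrite -fps_expand_eq0 rE tofrac_eq0; apply/eqP => /fpsP/(_ 0%N)/eqP.
  by rewrite r0 oner_eq0.
elim/ltn_ind: m => -[|[|m]] IHm.
- by exists 1; rewrite ?rmorph1.
- by exists (1 - x_ser); rewrite ?coef0_1Bx_ser ?fps_expand_1Bx.
have [r r0 rE] := IHm m (leqW (leqnn _)); have [s s0 sE] := IHm m.+1 (leqnn _).
exists (a_ser * s - x_ser ^+ 2 * r).
  rewrite fpsBE fps_coef0M coef0_a_ser s0 expr2 -mulrA fps_coef0M coef0_x_ser.
  by rewrite mul0r subr0 mulr1.
rewrite R_pltSS [LHS]rmorphB [RHS]rmorphB !expr2 !rmorphM /=.
by rewrite rE sE fps_expand_a fps_expand_x.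
Qed.

(** Dividing the recurrence by [R_(m+1)] gives [R_(m+2) / R_(m+1) = a - x^2 / (R_(m+1) / R_m)],
    starting from [R_1 / R_0 = 1 - x]. *)
Lemma R_plt_cfrac m : R_plt m / R_plt m.+1 = cfrac_plt m (1 - x_rat).
Proof.
rewrite /cfrac_plt div1r -[LHS]invrK invf_div; congr _^-1.
elim: m => [|m IHm]; first by rewrite divr1.
rewrite R_pltSS mulrBl mulfK ?R_plt_neq0 // [iter _ _ _]/= -IHm invf_div.
by rewrite mulrA.
Qed.

Theorem theorem12 :
  (forall m : nat, (1 <= m)%N ->
     (Fplt_bounded m)%:F = fps_expand (R_plt m / R_plt m.+1) /\
     R_plt m / R_plt m.+1 = cfrac_plt m (1 - x_rat)) /\
  ratfun_cvg (fun k => cfrac_plt k a_plt) Fplt /\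
  Fplt%:F =
    (1 - 2%:R * x_ser - x_ser ^+ 2 * (t_ser - 2%:R)
      - fps_sqrt (1 - 4%:R * x_ser - 2%:R * x_ser ^+ 2 * (t_ser - 2%:R)
                    + 4%:R * x_ser ^+ 3 * t_ser + x_ser ^+ 4 * t_ser * (t_ser - 4%:R)))%:F
    / (2%:R * (x_ser ^+ 2 - x_ser ^+ 3))%:F.
Proof.
split=> [m _|].
  split; last exact: R_plt_cfrac.
  rewrite R_plt_cfrac (fps_expand_cfrac m unit_1Bx_ser fps_expand_1Bx).
  by rewrite Fplt_bounded_cfrac.
split.
  (* The truncations of the infinite fraction end in [a] itself, so the tail is [a_ser] here instead
     of [1 - x_ser]. *)
  exists (cfrac_ser a_ser); split; last exact: cfrac_ser_cvg.
  move=> k; apply: fps_expand_cfrac fps_expand_a.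
  exact: fps_unit_coef0_1 coef0_a_ser.
have x_neq0 : x_ser != 0.
  rewrite -(rmorph0 (@fps_of_poly {poly rat})) (inj_eq (@fps_of_poly_inj _)).
  by rewrite polyX_eq0.
have den_neq0 : 2%:R * (x_ser ^+ 2 - x_ser ^+ 3) != 0.
  rewrite (_ : x_ser ^+ 2 - _ = x_ser ^+ 2 * (1 - x_ser)); last by ring.
  rewrite !mulf_neq0 ?expf_neq0 //.
    apply: contraTneq two_unit_polyQ => /fpsP/(_ 0%N) two0.
    by have -> : (2%:R : {poly rat}) = 0 by []; rewrite unitr0.
  by apply: contraTneq unit_1Bx_ser => ->; rewrite unitr0.
by rewrite Fplt_sqrt rmorphM /= mulrC mulKf // tofrac_eq0.
Qed.
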